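(* Let $A$ be a non-zero positive bounded operator on a complex Hilbert space $\mathscr{H}$ and let $B,C\in\mathbb{B}_A(\mathscr{H})$. Then $$\frac12\max\big\{w_A^2(B+C)+c_A^2(B-C),\ w_A^2(B-C)+c_A^2(B+C)\big\}\le w_{A,e}^2(B,C).$$
   Context: $\mathbb{B}(\mathscr{H})$ is the algebra of bounded linear operators on $\mathscr{H}$. For $x,y\in\mathscr{H}$, $\langle x,y\rangle_A=\langle Ax,y\rangle$ and $\|x\|_A=\langle Ax,x\rangle^{1/2}$. $\mathbb{B}_A(\mathscr{H})$ is the set of $T\in\mathbb{B}(\mathscr{H})$ for which there is $S\in\mathbb{B}(\mathscr{H})$ with $AS=T^*A$. The $A$-numerical radius and $A$-Crawford number are $w_A(T)=\sup\{|\langle Tx,x\rangle_A|:\|x\|_A=1\}$ and $c_A(T)=\inf\{|\langle Tx,x\rangle_A|:\|x\|_A=1\}$. The $A$-Euclidean operator radius of a pair is $w_{A,e}(B,C)=\sup\{(|\langle Bx,x\rangle_A|^2+|\langle Cx,x\rangle_A|^2)^{1/2}: \|x\|_A=1\}$. Superscript $2$ on $w_A$, $c_A$ and $w_{A,e}$ denotes the square of the value. *)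

(* Defs.v *)
From HB Require Import structures.
From mathcomp Require Import all_boot all_order all_algebra.
From mathcomp Require Import sesquilinear complex.
From mathcomp Require Import all_classical all_reals all_analysis.

Set Implicit Arguments.
Unset Strict Implicit.
Unset Printing Implicit Defensive.

Import Order.TTheory GRing.Theory Num.Theory.
Import numFieldNormedType.Exports.

Local Open Scope classical_set_scope.
Local Open Scope complex_scope.
Local Open Scope ring_scope.

Section Defs.
Variables (R : realType) (H : completeNormedModType R[i]).

(* Together with the completeness of H, makes (H, ip) a complex Hilbert space;
   ip is linear in its first argument and conjugate-linear in the second. *)
Definition induces_norm (ip : {dot H for Num.conj}) : Prop :=
  forall x : H, `|x| ^+ 2 = ip x x.

Definition bounded_op (T : {linear H -> H}) : Prop :=
  exists M : R, forall x : H, `|T x| <= M%:C * `|x|.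

(* The norm of R[i] takes its values in R[i]; this is the modulus as a real. *)
Definition modulus (z : R[i]) : R := complex.Re `|z|.

Variable ip : {dot H for Num.conj}.

(* The order of R[i] makes this say that ip (A x) x is real and nonnegative. *)
Definition positive_op (A : H -> H) : Prop := forall x : H, 0 <= ip (A x) x.

Definition is_adjoint (T Tstar : H -> H) : Prop :=
  forall x y : H, ip (T x) y = ip x (Tstar y).

Section SemiInner.
Variable A : H -> H.

Definition ipA (x y : H) : R[i] := ip (A x) y.

(* For positive A, ipA x x is real, so taking its real part loses nothing. *)
Definition normA (x : H) : R := Num.sqrt (complex.Re (ipA x x)).

(* Membership in B_A(H), the adjoint of T being given by its defining
   property; on a Hilbert space it exists and is unique. *)
Definition BA (T : {linear H -> H}) : Prop :=
  bounded_op T /\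
  exists Tstar S : {linear H -> H},
    [/\ bounded_op Tstar, is_adjoint T Tstar,
        bounded_op S & A \o S = Tstar \o A].

Definition wA (T : H -> H) : R :=
  sup [set modulus (ipA (T x) x) | x in [set x | normA x = 1]].

Definition cA (T : H -> H) : R :=
  inf [set modulus (ipA (T x) x) | x in [set x | normA x = 1]].

Definition wAe (B C : H -> H) : R :=
  sup [set Num.sqrt (modulus (ipA (B x) x) ^+ 2 + modulus (ipA (C x) x) ^+ 2)
      | x in [set x | normA x = 1]].

End SemiInner.
End Defs.

(* Main.v *)
Require Import Defs.
From HB Require Import structures.
From mathcomp Require Import all_boot all_order all_algebra.
From mathcomp Require Import sesquilinear complex.
From mathcomp Require Import all_classical all_reals all_analysis.
From mathcomp Require Import ring lra.

Set Implicit Arguments.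
Unset Strict Implicit.
Unset Printing Implicit Defensive.

Import Order.TTheory GRing.Theory Num.Theory.
Import numFieldNormedType.Exports.

Local Open Scope complex_scope.
Local Open Scope ring_scope.

(** Pointwise, the parallelogram identity
    [|b + c|^2 + |b - c|^2 = 2 (|b|^2 + |c|^2)] bounds [|b + c|^2] by
    [2 w_{A,e}^2 - c_A^2 (B - C)], and taking suprema gives the claim. Since a
    real [sup] of an unbounded set is 0, this requires [w_{A,e}(B,C)] to be
    finite, i.e. operators in [B_A(H)] to have a bounded [A]-numerical range.
    If [A S = T^* A], then [P = S T] is symmetric for [<.,.>_A], and for
    [||x||_A = 1] Cauchy-Schwarz gives [|<Tx,x>_A|^2 <= <Px,x>_A] and
    [|<P^k x,x>_A|^2 <= <P^(2k) x,x>_A]. Hence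
    [<Px,x>_A^(2^n) <= |<P^(2^n) x,x>_A| <= ||A|| ||P||^(2^n) ||x||^2] for all
    [n], which forces [<Px,x>_A <= ||P||], uniformly in [x]. *)

Section PosSemidefForm.
Variables (C : numClosedFieldType) (U : lmodType C).
Variable f : {bilinear U -> U -> C | *%R & Num.conj \; *%R}.
Hypothesis f_ge0 : forall x, 0 <= f x x.

(* By polarization: [f] takes real values at [x + y] and [x + 'i y]. *)
Lemma psd_form_conjC x y : f y x = (f x y)^*.
Proof.
have fxx_real z : (f z z)^* = f z z by apply: conj_Creal; rewrite ger0_real.
have /(congr1 (fun z => 'i * z)) := fxx_real (x + 'i *: y).
have := fxx_real (x + y).
rewrite !linearDl !linearDr /= !linearZl_LR !linearZr_LR /=.
rewrite !rmorphD !rmorphM /=.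
rewrite !conjCK !conjCi !fxx_real /GRing.scale /= => e1 e2.
have {}e2 : f y x + (f y x)^* - (f x y + (f x y)^*) = 0.
  apply/(mulfI (neq0Ci C))/(mulfI (neq0Ci C)).
  by move/esym/eqP: e2; rewrite -subr_eq0 !mulr0 => /eqP <-; ring.
move/eqP: e1; rewrite -subr_eq0 => /eqP e1.
apply/eqP; rewrite -subr_eq0 -[_ == 0](mulrn_eq0 _ 2); apply/eqP.
by rewrite -[RHS](subrr 0) -[X in _ = X - _]e2 -[X in _ = _ - X]e1; ring.
Qed.

(** The form may be degenerate, so [c] or [a] can vanish. Nonnegativity is tested at
    [c *: x - b *: y] if [c] is nonzero, at [b^* *: x - a *: y] if [a] is, and otherwise at
    [x - b *: y], where the form equals [- 2 |b|^2] and forces [b = 0]. *)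
Lemma psd_form_CauchySchwarz x y : `|f x y| ^+ 2 <= f x x * f y y.
Proof.
set a := f x x; set b := f x y; set c := f y y.
have exp s t : f (s *: x - t *: y) (s *: x - t *: y) =
    s * s^* * a - s * t^* * b - t * s^* * b^* + t * t^* * c.
  rewrite linearBl !linearBr /= ![in LHS]linearZl_LR ![in LHS]linearZr_LR /=.
  by rewrite /GRing.scale /= (psd_form_conjC x y) -/a -/b -/c; ring.
have a_real : a^* = a by apply: conj_Creal; rewrite ger0_real // f_ge0.
have c_real : c^* = c by apply: conj_Creal; rewrite ger0_real // f_ge0.
rewrite normCK.
have [c0|c_neq0] := eqVneq c 0; last first.
  have c_gt0 : 0 < c by rewrite lt_def c_neq0 /c f_ge0.
  have := f_ge0 (c *: x - b *: y); rewrite exp c_real.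
  have -> : c * c * a - c * b^* * b - b * c * b^* + b * b^* * c =
            c * (a * c - b * b^*) by ring.
  by rewrite pmulr_rge0// subr_ge0.
have [a0|a_neq0] := eqVneq a 0; last first.
  have a_gt0 : 0 < a by rewrite lt_def a_neq0 /a f_ge0.
  have := f_ge0 (b^* *: x - a *: y); rewrite exp a_real conjCK.
  have -> : b^* * b * a - b^* * a * b - a * b * b^* + a * a * c =
            a * (a * c - b * b^*) by ring.
  by rewrite pmulr_rge0// subr_ge0.
have := f_ge0 (x - b *: y); have := exp 1 b; rewrite scale1r => ->.
rewrite a0 c0 conjC1 !mulr0 !mul1r !mulr1 sub0r addr0 (mulrC b^*) -opprD oppr_ge0.
by rewrite -mulr2n pmulrn_lle0.
Qed.

End PosSemidefForm.

(** If [b < a], then [K * (b / a) ^+ n] tends to 0 and drops below 1, against the hypothesis at a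
    large power of two. *)
Lemma le_of_expn_pow2 (R : realType) (K a b : R) : 0 <= a -> 0 <= b ->
  (forall n, a ^+ (2 ^ n) <= K * b ^+ (2 ^ n)) -> a <= b.
Proof.
move=> a_ge0 b_ge0 ab; rewrite leNgt; apply/negP => lt_ba.
have a_gt0 : 0 < a := le_lt_trans b_ge0 lt_ba.
have q_lt1 : `|b / a| < 1 by rewrite ger0_norm ?divr_ge0// ltr_pdivrMr// mul1r.
have Kq_lt1 : (\forall n \near \oo, K * (b / a) ^+ n < 1)%classic.
  have : (K * (b / a) ^+ n @[n --> \oo] --> K * 0)%classic.
    by apply: cvgM; [exact: cvg_cst|exact: cvg_expr].
  by rewrite mulr0 => /cvgr_lt; apply; exact: ltr01.
(* The exponent [2 ^ N] lies beyond the rank [N] because [N < 2 ^ N]. *)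
have [N _ /(_ (2 ^ N)%N)] := Kq_lt1.
rewrite /= (ltnW (ltn_expl _ _))// => /(_ isT).
by rewrite expr_div_n mulrA ltr_pdivrMr ?exprn_gt0// mul1r ltNge ab.
Qed.

Section Modulus.
Variable R : realType.
Implicit Types z w : R[i].

Lemma modulusE z : (modulus z)%:C = `|z|.
Proof. by rewrite /modulus normc_def. Qed.

Lemma sqr_modulus z : modulus z ^+ 2 = complex.Re z ^+ 2 + complex.Im z ^+ 2.
Proof. by rewrite /modulus normc_def /= sqr_sqrtr// addr_ge0 ?sqr_ge0. Qed.

Lemma modulus_ge0 z : 0 <= modulus z.
Proof. by rewrite -ler0c modulusE normr_ge0. Qed.

Lemma modulus_parallelogram z w :
  modulus (z + w) ^+ 2 + modulus (z - w) ^+ 2 =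
  2 * (modulus z ^+ 2 + modulus w ^+ 2).
Proof. by rewrite !sqr_modulus; case: z w => [a b] [c d] /=; ring. Qed.

End Modulus.

(** Each doubling of the exponent is one Cauchy-Schwarz against the unit vector [x]: by symmetry
    [f (P^(2k) x) x = f (P^k x) (P^k x)]. *)
Lemma psd_form_iter (R : realType) (U : lmodType R[i])
    (f : {bilinear U -> U -> R[i] | *%R & Num.conj \; *%R}) (P : U -> U) x n :
  (forall x, 0 <= f x x) -> (forall y z, f (P y) z = f y (P z)) -> f x x = 1 ->
  modulus (f (P x) x) ^+ (2 ^ n) <= modulus (f (iter (2 ^ n) P x) x).
Proof.
move=> f_ge0 fP fxx; elim: n => [|n IHn]; first by rewrite expr1.
have fiter m y z : f (iter m P y) z = f y (iter m P z).
  by elim: m z => // m IHm z; rewrite iterS fP IHm -iterSr.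
rewrite expnSr exprM muln2 -addnn iterD fiter.
apply: (@le_trans _ _ (modulus (f (iter (2 ^ n) P x) x) ^+ 2)).
  by rewrite lerXn2r// nnegrE ?exprn_ge0 ?modulus_ge0.
rewrite -lecR rmorphXn /= !modulusE.
by rewrite (le_trans (psd_form_CauchySchwarz f_ge0 _ _))// fxx mulr1 ger0_norm.
Qed.

Section OperatorBounds.
Variables (R : realType) (H : completeNormedModType R[i]).

Lemma bounded_op_ge0 (T : {linear H -> H}) : bounded_op T ->
  exists2 M : R, 0 <= M & forall x, `|T x| <= M%:C * `|x|.
Proof.
move=> [M TM]; exists `|M| => // x; rewrite (le_trans (TM x))//.
by rewrite ler_wpM2r// lecR ler_norm.
Qed.

Variable ip : {dot H for Num.conj}.
Hypothesis Hip : induces_norm ip.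

Lemma ip_le_norm x y : `|ip x y| <= `|x| * `|y|.
Proof.
rewrite -ler_sqr ?nnegrE ?mulr_ge0// exprMn !Hip.
by apply: psd_form_CauchySchwarz => z; exact: dnorm_ge0.
Qed.

Variable A : {linear H -> H}.

(** Makes the results on semidefinite forms applicable to [ipA]. *)
Fact ipA_bilinear_for : bilinear_for
  (GRing.Scale.Law.clone _ _ *%R _) (GRing.Scale.Law.clone _ _ (Num.conj \; *%R) _)
  (ipA ip A).
Proof.
by split=> [u|u] a x y; rewrite /ipA ?linearP/= ?linearPl ?linearPr.
Qed.
HB.instance Definition _ :=
  bilinear_isBilinear.Build _ _ _ _ _ _ (ipA ip A) ipA_bilinear_for.

Hypotheses (A_bounded : bounded_op A) (A_positive : positive_op ip A).

Lemma normA1 x : normA ip A x = 1 -> ipA ip A x x = 1.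
Proof.
move=> x1; have := A_positive x; rewrite -/(ipA ip A x x).
case: (ipA ip A x x) {x1}(x1 : Num.sqrt _ = 1) => a b /= a1.
move=> ab_ge0; have /= -> := ger0_Im ab_ge0.
have a_ge0 : 0 <= a by move: ab_ge0; rewrite lecE => /andP[].
by rewrite -(sqr_sqrtr a_ge0) a1 expr1n.
Qed.

Lemma BA_bounded (T : {linear H -> H}) : BA ip A T ->
  exists M : R, forall x, normA ip A x = 1 ->
    modulus (ipA ip A (T x) x) ^+ 2 <= M.
Proof.
move=> [/bounded_op_ge0[MT MT0 TM] [Tstar [S []]]] _ adjT.
move=> /bounded_op_ge0[MS MS0 SM] AS.
have [MA MA0 AM] := bounded_op_ge0 A_bounded.
pose f : {bilinear H -> H -> R[i] | *%R & Num.conj \; *%R} := ipA ip A.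
have f_ge0 x : 0 <= f x x by exact: A_positive.
have fC x y : f y x = Num.conj (f x y) by exact: psd_form_conjC.
(* [S] acts as an adjoint of [T] for the form [f]. *)
have fS x y : f (S x) y = f x (T y).
  have /(congr1 (@^~ x))/= ASx := AS.
  have ipC u v : ip u v = (ip v u)^* by rewrite hermC mul1r.
  by rewrite /f /= /ipA ASx ipC -adjT -ipC.
pose P := S \o T.
have fP y z : f (P y) z = f y (P z) by rewrite fS [RHS]fC fS -fC.
have Px n x : `|iter n P x| <= ((MS * MT) ^+ n)%:C * `|x|.
  elim: n => [|n IHn] /=; first by rewrite mul1r.
  rewrite (le_trans (SM _))// exprS rmorphM /= -mulrA.
  rewrite [in leRHS]rmorphM /= -mulrA ler_wpM2l ?ler0c//.
  by rewrite (le_trans (TM _))// ler_wpM2l ?ler0c.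
exists (MS * MT) => x x1; have fxx : f x x = 1 by exact: normA1.
(* Cauchy-Schwarz against [x] leaves [f (T x) (T x)], which is [f (P x) x]. *)
apply: (@le_trans _ _ (modulus (f (P x) x))).
  rewrite -lecR rmorphXn /= !modulusE.
  by rewrite (le_trans (psd_form_CauchySchwarz f_ge0 _ _))// fxx mulr1 fS ger0_norm.
(* This factor depends on [x], and [|x|] need not be bounded on [normA ip A x = 1]; it disappears in
   the limit over [n], so the bound [MS * MT] is uniform. *)
apply: (@le_of_expn_pow2 _ (MA * modulus `|x| ^+ 2)).
- exact: modulus_ge0.
- exact: mulr_ge0.
move=> n; apply: le_trans (psd_form_iter _ f_ge0 fP fxx) _.
rewrite -lecR modulusE.
have -> : (MA * modulus `|x| ^+ 2 * (MS * MT) ^+ (2 ^ n))%:C =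
    MA%:C * (((MS * MT) ^+ (2 ^ n))%:C * `|x|) * `|x|.
  rewrite [LHS]rmorphM [X in X * _ = _]rmorphM [X in _ * X * _ = _]rmorphXn /=.
  by rewrite modulusE normr_id; ring.
rewrite (le_trans (ip_le_norm _ _))// ler_wpM2r//.
by rewrite (le_trans (AM _))// ler_wpM2l ?ler0c.
Qed.

End OperatorBounds.

Lemma sqr_sup_inf_le (R : realType) (T : Type) (X : set T) (f g h : T -> R) :
  (forall x, 0 <= f x) -> (forall x, 0 <= g x) -> (forall x, 0 <= h x) ->
  (forall x, f x ^+ 2 + g x ^+ 2 = 2 * h x ^+ 2) ->
  has_ubound (h @` X)%classic ->
  sup (f @` X)%classic ^+ 2 + inf (g @` X)%classic ^+ 2 <=
    2 * sup (h @` X)%classic ^+ 2.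
Proof.
move=> f_ge0 g_ge0 h_ge0 fgh hX.
(* [sup] and [inf] of the empty set are 0. *)
have [->|/set0P[x0 Xx0]] := eqVneq X set0%classic.
  by rewrite !image_set0 sup0 inf0 expr0n /= mulr0 addr0.
set s := sup (h @` X)%classic; set i := inf _.
have i_ge0 : 0 <= i.
  by apply: lb_le_inf => [|_ [x _ <-]]; first by exists (g x0), x0.
have f_le x : X x -> f x ^+ 2 <= 2 * s ^+ 2 - i ^+ 2.
  move=> Xx; have h_le : h x <= s by apply: ub_le_sup => //; exists x.
  have g_ge : i <= g x by apply: ge_inf; [exists 0 => _ [y _ <-]|exists x].
  have hs2 : h x ^+ 2 <= s ^+ 2 by rewrite lerXn2r// nnegrE (le_trans (h_ge0 x)).
  have gi2 : i ^+ 2 <= g x ^+ 2 by rewrite lerXn2r// nnegrE.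
  by have := fgh x; lra.
(* With this sign, the bound on squares becomes a bound on [f] by a square root, which passes to the
   supremum. *)
have r_ge0 : 0 <= 2 * s ^+ 2 - i ^+ 2 := le_trans (sqr_ge0 _) (f_le _ Xx0).
rewrite -lerBrDr -(sqr_sqrtr r_ge0) lerXn2r ?nnegrE ?sqrtr_ge0//.
  apply: (le_trans (f_ge0 x0)); apply: ub_le_sup; last by exists x0.
  exists (Num.sqrt (2 * s ^+ 2 - i ^+ 2)) => _ [x Xx <-].
  by rewrite -(ger0_norm (f_ge0 x)) -sqrtr_sqr ler_sqrt// f_le.
apply: ge_sup => [|_ [x Xx <-]]; first by exists (f x0), x0.
by rewrite -(ger0_norm (f_ge0 x)) -sqrtr_sqr ler_sqrt// f_le.
Qed.

Theorem theorem2p18 (R : realType) (H : completeNormedModType R[i])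
    (ip : {dot H for Num.conj}) (Hip : induces_norm ip)
    (A B C : {linear H -> H})
    (A_bounded : bounded_op A) (A_positive : positive_op ip A)
    (A_neq0 : (A : H -> H) <> \0)
    (B_BA : BA ip A B) (C_BA : BA ip A C) :
  2^-1 * Num.max (wA ip A (B \+ C) ^+ 2 + cA ip A (B \- C) ^+ 2)
                 (wA ip A (B \- C) ^+ 2 + cA ip A (B \+ C) ^+ 2)
    <= wAe ip A B C ^+ 2.
Proof.
have [MB hB] := BA_bounded Hip A_bounded A_positive B_BA.
have [MC hC] := BA_bounded Hip A_bounded A_positive C_BA.
rewrite mulrC ler_pdivrMr// [leRHS]mulrC ge_max.
pose q (T : H -> H) x := modulus (ipA ip A (T x) x).
have q_parallelogram x : q (B \+ C) x ^+ 2 + q (B \- C) x ^+ 2 =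
    2 * Num.sqrt (q B x ^+ 2 + q C x ^+ 2) ^+ 2.
  rewrite sqr_sqrtr ?addr_ge0 ?sqr_ge0// -modulus_parallelogram.
  by rewrite /q /ipA /= linearD linearB /= linearDl linearBl.
have q_bounded : has_ubound [set Num.sqrt (q B x ^+ 2 + q C x ^+ 2) |
    x in [set x | normA ip A x = 1]]%classic.
  exists (Num.sqrt (MB + MC)) => _ [x /= x1 <-].
  by rewrite ler_wsqrtr// lerD// (hB, hC).
(* The two terms of the maximum differ by exchanging [B \+ C] and [B \- C], under which the
   parallelogram identity is symmetric. *)
apply/andP; split; apply: sqr_sup_inf_le => // x;
  first [exact: modulus_ge0 | by rewrite addrC; exact: q_parallelogram].
Qed.
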